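(* Let $K$ be a field with algebraic closure $\overline{K}$, and let $f_1,f_2\in K[x]\setminus K$. For $a\in\overline{K}$ and $i\in\{1,2\}$ let $m_i(a)$ denote the multiplicity of $x=a$ as a root of $f_i(x)-f_i(a)$. Then $f_1$ and $f_2$ have a common composite if and only if there is a nonempty finite subset $A$ of $\overline{K}$ which admits a function $\ell:A\to\mathbb{Z}$ such that (i) for $a\in A$ and $i\in\{1,2\}$, $\ell(a)/m_i(a)$ is a positive integer; and (ii) for $i\in\{1,2\}$, $a\in A$, and $b\in\overline{K}$, if $f_i(a)=f_i(b)$ then $b\in A$ and $\ell(a)/m_i(a)=\ell(b)/m_i(b)$.
   Context: $K$ is an arbitrary field (any characteristic). Nonconstant polynomials $f_1,f_2\in K[x]$ have a common composite (over $K$) if there are nonconstant $u,v\in K[x]$ such that $u(f_1(x))=v(f_2(x))$; any such polynomial $u(f_1(x))$ is called a common composite of $f_1$ and $f_2$. *)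

(* Defs.v *)
From mathcomp Require Import all_boot all_order all_algebra finmap.

Set Implicit Arguments.
Unset Strict Implicit.
Unset Printing Implicit Defensive.

Import GRing.Theory Num.Theory.

Local Open Scope ring_scope.

Definition nonconstant (R : nzSemiRingType) (p : {poly R}) : Prop :=
  (1 < size p)%N.

(* [q \Po p] is q(p(x)). *)
Definition have_common_composite (K : fieldType) (f1 f2 : {poly K}) : Prop :=
  exists u v : {poly K},
    [/\ nonconstant u, nonconstant v & u \Po f1 = v \Po f2].

(* An algebraic closure of K is an algebraically closed field L together with
   an embedding of K in L over which every element of L is algebraic. *)
Definition algebraic_closure (K : fieldType) (L : closedFieldType)
    (iota : {rmorphism K -> L}) : Prop :=
  forall x : L, algebraicOver iota x.

Section Multiplicity.

Variables (K : fieldType) (L : closedFieldType) (iota : {rmorphism K -> L}).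

Definition evalL (f : {poly K}) (a : L) : L := (map_poly iota f).[a].

Definition fiber_mult (f : {poly K}) (a : L) : nat :=
  mup a (map_poly iota f - (evalL f a)%:P).

(* The quotient l(a) / m(a), taken in the rationals: divisibility is not
   presupposed. *)
Definition mult_quotient (f : {poly K}) (A : {fset L}) (l : A -> int) (a : A)
    : rat :=
  (l a)%:Q / (fiber_mult f (\val a))%:Q.

End Multiplicity.

(* Main.v *)
Require Import Defs.
From mathcomp Require Import all_boot all_order all_algebra finmap.

Set Implicit Arguments.
Unset Strict Implicit.
Unset Printing Implicit Defensive.

Import Order.TTheory GRing.Theory Num.Theory.

Local Open Scope ring_scope.

(** Write F for f1 or f2 over the algebraically closed field L, and m_F(a) for
    the ramification index of F at a, i.e. the multiplicity of a as a root of
    F - F(a).  If u has order e at the point F(a), then u o F has order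
    e * m_F(a) at a ([mup_comp]).  Conversely, over an algebraically closed
    field a nonzero polynomial is determined up to a scalar by its orders at
    all points ([closed_field_mup_inj]).  Hence G is of the form u o F exactly
    when the order of G at a equals e(F(a)) * m_F(a) for some function e on L,
    which is then the divisor of u ([composite_criterion]).

    Finite sets A with a positive function l correspond to nonzero polynomials
    G up to scalars, l(a) being the order of G at a.  Conditions (i) and (ii)
    say precisely that l(a) / m_F(a) is a natural number depending on F(a) only,
    that is, that G is a composite of both f1 and f2.  Starting from a common
    composite over K this gives A and l at once.  In the other direction it
    gives a common composite over L, and coefficients are brought down to K by
    linear algebra: for bounded degrees and u(0) = 0, the equation
    u o f1 = v o f2 is a homogeneous linear system over K in the coefficients
    of u and v, and the existence of a nonzero solution does not depend on the
    field in which solutions are sought ([common_composite_descent]). *)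

(** * Descent of common composites along a field extension *)

Lemma nonconstant_comp (R : idomainType) (p q : {poly R}) :
  nonconstant (p \Po q) <-> nonconstant p /\ nonconstant q.
Proof.
have degE (r : {poly R}) : (1 < size r)%N = (0 < (size r).-1)%N by case: size.
rewrite /nonconstant !degE size_comp_poly muln_gt0.
by split=> [/andP | [-> ->]].
Qed.

(** The matrix of the linear map p |-> g * (p o f) on polynomials p with n
    coefficients.  Taking g = f gives p |-> ('X * p) o f, which restricts the
    outer polynomial to those vanishing at 0. *)
Definition comp_mx (F : fieldType) n N (g f : {poly F}) : 'M[F]_(n, N) :=
  \matrix_(i < n) poly_rV (g * f ^+ i).

Lemma mul_comp_mx (F : fieldType) n N (g f : {poly F}) (x : 'rV[F]_n) :
  x *m comp_mx n N g f = poly_rV (g * (rVpoly x \Po f)).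
Proof.
rewrite mulmx_sum_row [in RHS](row_sum_delta x) !raddf_sum /= mulr_sumr.
rewrite linear_sum.
apply: eq_bigr => i _; rewrite rowK linearZ /= rVpoly_delta.
by rewrite comp_polyZ comp_Xn_poly -scalerAr linearZ.
Qed.

Lemma map_comp_mx (K L : fieldType) (iota : {rmorphism K -> L}) n N
    (g f : {poly K}) :
  map_mx iota (comp_mx n N g f)
    = comp_mx n N (map_poly iota g) (map_poly iota f).
Proof.
apply/matrixP=> i j.
by rewrite !mxE -rmorphXn -rmorphM /= coef_map.
Qed.

(** The trivial solutions u = v constant of u o f1 = v o f2 have to be kept
    out of the linear system.  Subtracting u(0) from both sides makes u
    divisible by 'X, and every nonzero solution (u', v) of
    ('X * u') o f1 = v o f2 has 'X * u' and v nonconstant.  The rank of the system is the same over K and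
    over L, so that a nonzero solution over L forces one over K. *)
Lemma common_composite_descent (K L : fieldType) (iota : {rmorphism K -> L})
    (f1 f2 : {poly K}) :
    nonconstant f1 -> nonconstant f2 ->
    have_common_composite (map_poly iota f1) (map_poly iota f2) ->
  have_common_composite f1 f2.
Proof.
move=> f1_nc f2_nc [u [v [u_nc _ uv]]].
have [u' [c uE]] : exists u' c, u = u' * 'X + c%:P.
  have /factor_theorem[u' Du'] : root (u - (u.[0])%:P) 0.
    by rewrite rootE !hornerE subrr.
  by exists u', u.[0]; rewrite -['X]subr0 -Du' subrK.
(* The sign turns u o f1 = v o f2 into membership in the kernel of a stacked
   matrix. *)
pose v' := c%:P - v.
have u'v' : map_poly iota f1 * (u' \Po map_poly iota f1)
            + (v' \Po map_poly iota f2) = 0.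
  rewrite /v' comp_polyB comp_polyC -uv uE comp_poly_MXaddC mulrC addrA.
  exact: subrr.
have u'_neq0 : u' != 0.
  apply: contraTneq u_nc => u'0.
  by rewrite uE u'0 mul0r add0r -leqNgt size_polyC leq_b1.
pose n := size u'; pose m := size v'.
(* With N coefficients nothing is truncated: N bounds the size of
   ('X * p) o f1 + q o f2 for p and q of sizes at most n and m. *)
pose N := (n * size f1 + m * size f2).+1.
pose M := col_mx (comp_mx n N f1 f1) (comp_mx m N 1 f2).
have MnF : ~~ row_free (map_mx iota M).
  apply/negP => /mulmx_free_eq0 M_inj.
  have : row_mx (poly_rV u') (poly_rV v') == 0 :> 'rV[L]_(n + m).
    rewrite -(M_inj _ (row_mx _ _)) map_col_mx !map_comp_mx mul_row_col.
    by rewrite !mul_comp_mx !poly_rV_K // -linearD /= rmorph1 mul1r u'v' linear0.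
  rewrite row_mx_eq0 => /andP[/eqP u'0 _].
  by rewrite -(poly_rV_K (leqnn (size u'))) u'0 linear0 eqxx in u'_neq0.
move: MnF; rewrite row_free_map -kermx_eq0 => /rowV0Pn[w /sub_kermxP].
rewrite -[w]hsubmxK mul_row_col !mul_comp_mx mul1r -linearD /=.
set x := rVpoly (lsubmx w); set y := rVpoly (rsubmx w) => wM w_neq0.
have xy : f1 * (x \Po f1) + (y \Po f2) = 0.
  have sz : (size (f1 * (x \Po f1) + (y \Po f2))%R <= N)%N.
    rewrite (leq_trans (size_polyD _ _)) // geq_max; apply/andP; split.
      have -> : f1 * (x \Po f1) = ('X * x) \Po f1.
        by rewrite comp_polyM comp_polyX.
      apply: leq_trans (size_comp_poly_leq _ _) _.
      rewrite ltnS (leq_trans _ (leq_addr _ _)) // leq_mul ?leq_pred //.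
      have := size_polyMleq 'X x; rewrite size_polyX => szXx.
      by rewrite -subn1 leq_subLR (leq_trans szXx) // ltnS size_poly.
    apply: leq_trans (size_comp_poly_leq _ _) _.
    rewrite ltnS (leq_trans _ (leq_addl _ _)) // leq_mul ?leq_pred //.
    by apply: leq_trans (leq_pred _) (size_poly _ _).
  by rewrite -(poly_rV_K sz) wM linear0.
have x_neq0 : x != 0.
  apply: contraNneq w_neq0 => x0; move: xy.
  rewrite x0 comp_poly0 mulr0 add0r => /eqP.
  rewrite comp_poly_eq0 // => /eqP y0.
  rewrite -[lsubmx w]rVpolyK -[rsubmx w]rVpolyK -/x -/y x0 y0.
  by rewrite !linear0 row_mx0.
have uv' : ('X * x) \Po f1 = - y \Po f2.
  by rewrite comp_polyM comp_polyX raddfN /=; apply/eqP; rewrite -addr_eq0 xy.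
have Xx_nc : nonconstant ('X * x).
  by rewrite /nonconstant mulrC size_mulX // ltnS size_poly_gt0.
exists ('X * x), (- y); split=> //.
by have /nonconstant_comp[] : nonconstant (- y \Po f2)
  by rewrite -uv'; apply/nonconstant_comp.
Qed.

(** * Orders of vanishing and composition *)

Section Ramification.

Variable F : fieldType.

Lemma mup_gt0 (p : {poly F}) a : p != 0 -> (0 < mup a p)%N = root p a.
Proof. by move=> p_neq0; rewrite -XsubC_dvd // dvdp_XsubCl. Qed.

Definition ramification (f : {poly F}) (a : F) : nat :=
  mup a (f - f.[a]%:P).

Lemma subC_neq0 (f : {poly F}) c : nonconstant f -> f - c%:P != 0.
Proof.
rewrite subr_eq0; apply: contraTneq => ->.
by rewrite /nonconstant -leqNgt size_polyC leq_b1.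
Qed.

Lemma ramification_gt0 (f : {poly F}) a :
  nonconstant f -> (0 < ramification f a)%N.
Proof.
by move=> f_nc; rewrite mup_gt0 ?subC_neq0 // rootE !hornerE subrr.
Qed.

Lemma mupX (p : {poly F}) a n : p != 0 -> mup a (p ^+ n) = (n * mup a p)%N.
Proof.
move=> p_neq0; elim: n => [|n IHn]; first by rewrite mupNroot ?root1.
by rewrite exprS mupM ?expf_neq0 // IHn mulSn.
Qed.

(** Writing u = q * ('X - f(a))^k with q nonzero at f(a), the factor q o f
    does not vanish at a and the other one becomes (f - f(a))^k. *)
Lemma mup_comp (u f : {poly F}) a : nonconstant f -> u != 0 ->
  mup a (u \Po f) = (mup f.[a] u * ramification f a)%N.
Proof.
move=> f_nc u_neq0; have [k [q]] := multiplicity_XsubC u f.[a].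
rewrite u_neq0 /= => qNa ->.
rewrite mupMr // mup_XsubCX eqxx comp_polyM mupMr ?root_comp //.
by rewrite rmorphXn /= comp_polyB comp_polyX comp_polyC mupX ?subC_neq0.
Qed.

Lemma prod_XsubCX_neq0 (s : seq F) (n : F -> nat) :
  \prod_(y <- s) ('X - y%:P) ^+ n y != 0.
Proof.
by rewrite monic_neq0 // monic_prod // => y _; rewrite monic_exp ?monicXsubC.
Qed.

Lemma mup_prod_XsubCX (s : seq F) (n : F -> nat) x : uniq s ->
  mup x (\prod_(y <- s) ('X - y%:P) ^+ n y) = if x \in s then n x else 0%N.
Proof.
elim: s => [_|y s IHs /= /andP[yNs s_uniq]].
  by rewrite big_nil mupNroot ?root1.
rewrite big_cons mupM ?expf_neq0 ?polyXsubC_eq0 ?prod_XsubCX_neq0 //.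
rewrite mup_XsubCX IHs // inE [x == y]eq_sym.
by have [<-|_] := eqVneq y x; rewrite ?(negPf yNs) ?addn0.
Qed.

End Ramification.

(** Both polynomials split into linear factors, and the orders are the
    multiplicities in the two lists of roots. *)
Lemma closed_field_mup_inj (L : closedFieldType) (p q : {poly L}) :
  p != 0 -> q != 0 -> (forall x, mup x p = mup x q) -> exists c, p = c *: q.
Proof.
move=> p_neq0 q_neq0 eq_mup.
have [r Dp] := closed_field_poly_normal p.
have [s Dq] := closed_field_poly_normal q.
have mupE (t : {poly L}) rt : t != 0 ->
    t = lead_coef t *: \prod_(z <- rt) ('X - z%:P) ->
    forall x, mup x t = count_mem x rt.
  move=> t_neq0 Dt x; rewrite Dt -mul_polyC mupMr ?mu_prod_XsubC //.
  by rewrite rootC lead_coef_eq0.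
have rs : perm_eq r s.
  apply/allP=> x _ /=.
  by rewrite -(mupE _ _ p_neq0 Dp) -(mupE _ _ q_neq0 Dq) eq_mup.
exists (lead_coef p / lead_coef q).
rewrite {1}Dp {2}Dq scalerA divfK ?lead_coef_eq0 //.
by rewrite (perm_big _ rs).
Qed.

(** The function e is the divisor of u.  Given e, the polynomial u is
    the product of the ('X - c)^(e c) over the images c under f of the roots of
    G; then u o f and G have the same orders everywhere. *)
Lemma composite_criterion (L : closedFieldType) (f G : {poly L}) :
    nonconstant f -> G != 0 ->
  (exists u, G = u \Po f) <->
  (exists e : L -> nat, forall a, mup a G = (e f.[a] * ramification f a)%N).
Proof.
move=> f_nc G_neq0; split=> [[u Du]|[e De]].
  exists (fun c => mup c u) => a; rewrite Du mup_comp //.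
  by apply: contraNneq G_neq0 => u0; rewrite Du u0 comp_poly0.
have [r Dr] := closed_field_poly_normal G.
pose s := undup [seq f.[a] | a <- r].
pose u := \prod_(c <- s) ('X - c%:P) ^+ e c.
have u_neq0 : u != 0 by apply: prod_XsubCX_neq0.
have [||a|c Dc] := @closed_field_mup_inj _ G (u \Po f) => //.
- by rewrite comp_poly_eq0.
- rewrite mup_comp // mup_prod_XsubCX ?undup_uniq // De.
  (* Away from f(roots of G) the function e vanishes, since G does not have
     a root there and ramification indices are positive. *)
  case: ifPn => // faNs; have aNr : a \notin r.
    by apply: contra faNs => ar; rewrite mem_undup map_f.
  rewrite -De mupNroot // Dr rootZ ?lead_coef_eq0 //.
  by rewrite root_prod_XsubC.
by exists (c *: u); rewrite comp_polyZ.
Qed.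

(** * Common composites and weighted unions of fibres *)

(** Turns the integrality of a rational quotient, which is how condition (i)
    is phrased, into the factorization asked for by the divisor criterion. *)
Lemma int_quotientE (l : int) (m : nat) : (0 < m)%N ->
    l%:Q / m%:Q \is a Num.int ->
  `|l|%N = (`|numq (l%:Q / m%:Q)| * m)%N.
Proof.
move=> m_gt0 /intrP[q Dq]; rewrite Dq numq_int.
have m_neq0 : m%:Q != 0 by rewrite intr_eq0 eqz_nat -lt0n.
have -> : l = q * m.
  by apply: (@intr_inj rat); rewrite intrM -Dq divfK.
by rewrite abszM.
Qed.

Local Open Scope fset_scope.

Theorem theorem1p1 (K : fieldType) (L : closedFieldType)
    (iota : {rmorphism K -> L}) (iota_closure : algebraic_closure iota)
    (f1 f2 : {poly K}) (f1_nc : nonconstant f1) (f2_nc : nonconstant f2) :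
  have_common_composite f1 f2 <->
  exists A : {fset L}, A <> fset0 /\
  exists l : A -> int,
    (forall (a : A) (f : {poly K}), f = f1 \/ f = f2 ->
       mult_quotient iota f l a \is a Num.int /\ 0 < mult_quotient iota f l a)
    /\
    (forall (f : {poly K}) (a : A) (b : L), f = f1 \/ f = f2 ->
       evalL iota f (val a) = evalL iota f b ->
       exists b' : A, val b' = b /\
         mult_quotient iota f l a = mult_quotient iota f l b').
Proof.
have map_nc (f : {poly K}) : nonconstant f -> nonconstant (map_poly iota f).
  by rewrite /nonconstant size_map_poly.
have f_nc (f : {poly K}) : f = f1 \/ f = f2 -> nonconstant (map_poly iota f).
  by case=> ->; apply: map_nc.
split=> [[u [v [u_nc v_nc uv]]] | [A [A_neq0 [l [l_int l_fib]]]]].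
  pose G := map_poly iota (u \Po f1).
  have G_nc : nonconstant G by apply/map_nc/nonconstant_comp.
  have G_neq0 : G != 0 by rewrite -size_poly_gt0 ltnW.
  (* e is the divisor of the outer factor, so the quotients l / m_f are its
     values. *)
  have Ge f : f = f1 \/ f = f2 -> exists e : L -> nat,
      forall a, mup a G = (e (evalL iota f a) * fiber_mult iota f a)%N.
    move=> Df; apply/(composite_criterion (f_nc f Df) G_neq0).
    case: Df => ->; [exists (map_poly iota u) | exists (map_poly iota v)].
      by rewrite -map_comp_poly.
    by rewrite -map_comp_poly -uv.
  have [r Dr] := closed_field_poly_normal G.
  have rE a : (a \in [fset x in r]) = root G a.
    by rewrite inE Dr rootZ ?lead_coef_eq0 // root_prod_XsubC.
  exists [fset x in r]; split.
    have /closed_rootP[a Ga] : size G != 1%N by rewrite neq_ltn G_nc orbT.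
    by apply/eqP/fset0Pn; exists a; rewrite rE.
  exists (fun a => (mup (val a) G : int)).
  have qE f e : f = f1 \/ f = f2 ->
      (forall a, mup a G = (e (evalL iota f a) * fiber_mult iota f a)%N) ->
      forall a : [fset x in r], mult_quotient iota f
        (fun a : [fset x in r] => (mup (val a) G : int)) a
          = (e (evalL iota f (val a)))%:Q.
    move=> Df De a; rewrite /mult_quotient De PoszM intrM mulfK //.
    by rewrite intr_eq0 eqz_nat -lt0n; apply/ramification_gt0/f_nc.
  split=> [a f Df | f a b Df fab].
    have [e De] := Ge f Df; rewrite (qE f e) //; split; first exact: intr_int.
    have : root G (val a) by rewrite -rE; apply: valP.
    by rewrite ltr0z ltz_nat -mup_gt0 // De muln_gt0 => /andP[].
  have [e De] := Ge f Df.
  have Gb : b \in [fset x in r].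
    rewrite rE -mup_gt0 // De -fab muln_gt0 (ramification_gt0 _ (f_nc f Df)).
    have : root G (val a) by rewrite -rE; apply: valP.
    by rewrite -mup_gt0 // De muln_gt0 => /andP[-> _].
  by exists [` Gb]; split; rewrite // !(qE f e) //= fab.
pose n x := if insub x is Some a then `|l a|%N else 0%N.
pose G : {poly L} := \prod_(x <- A) ('X - x%:P) ^+ n x.
have G_neq0 : G != 0 by apply: prod_XsubCX_neq0.
have mupG x : mup x G = n x.
  rewrite mup_prod_XsubCX ?fset_uniq // /n.
  by case: insubP => [a -> _ | /negPf->].
have G_comp f : f = f1 \/ f = f2 -> exists u, G = u \Po map_poly iota f.
  move=> Df; apply/(composite_criterion (f_nc f Df) G_neq0).
  (* e c is the common quotient l / m_f on the fibre of f above c, read off at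
     any point of A in that fibre; a fibre meeting A lies in A, so the order of
     G is 0 on all of the other fibres. *)
  pose e c := if [pick a : A | evalL iota f (val a) == c] is Some a
              then `|numq (mult_quotient iota f l a)|%N else 0%N.
  exists e => x; rewrite mupG /n /e.
  case: pickP => [a /eqP fax | noA].
    have [b [bx qab]] := l_fib f a x Df fax.
    rewrite -bx valK qab; apply: int_quotientE.
      exact/ramification_gt0/f_nc.
    by have [] := l_int b f Df.
  case: insubP => [a _ ax|//].
  by have := noA a; rewrite ax eqxx.
have G_nc : nonconstant G.
  have /eqP/fset0Pn[a aA] := A_neq0.
  apply: (root_size_gt1 (a := a)); rewrite // -mup_gt0 // mupG /n.
  rewrite (insubT (mem A) aA) absz_gt0.
  have [_] := l_int [` aA] f1 (or_introl erefl).
  by apply: contraTneq; rewrite /mult_quotient => ->; rewrite mul0r ltxx.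
have [u Du] := G_comp f1 (or_introl erefl).
have [v Dv] := G_comp f2 (or_intror erefl).
apply: (common_composite_descent (iota := iota)) => //.
have [u_nc _] : nonconstant u /\ nonconstant (map_poly iota f1).
  by apply/nonconstant_comp; rewrite -Du.
have [v_nc _] : nonconstant v /\ nonconstant (map_poly iota f2).
  by apply/nonconstant_comp; rewrite -Dv.
by exists u, v; split; rewrite // -Du.
Qed.
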